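(* For $n \geq 1$ let $$\mathrm{ace}(n) = \{ \mathrm{cce}(x) : x \text{ is a factor of } \mathbf{t},\ |x| = n \},$$ where $\mathbf{t}$ is the Thue-Morse word and $\mathrm{cce}$ is the circular critical exponent. Then the range $\{\mathrm{ace}(n) : n \geq 1\}$ consists of exactly the following $31$ distinct sets: \begin{enumerate} \item $\{1\}$ \item $\{1,2\}$ \item $\{2\}$ \item $\{2,3\}$ \item $\{\frac52,3\}$ \item $\{2,4\}$ \item $\{\frac73,3,\frac72\}$ \item $\{2,3,4\}$ \item $\{\frac52,\frac83,3\}$ \item $\{\frac52,3,\frac{10}3,4\}$ \item $\{\frac52,3,\frac72\}$ \item $\{\frac73,\frac{13}5,\frac83,3\}$ \item $\{\frac73,3,\frac72,4\}$ \item $\{\frac52,\frac{13}5,\frac83,3\}$ \item $\{\frac52,\frac83,3,\frac{11}3,4\}$ \item $\{\frac73,\frac83,3,\frac72\}$ \item $\{\frac73,\frac52,\frac83,3\}$ \item $\{\frac52,3,\frac72,\frac{11}3,4\}$ \item $\{\frac{17}7,\frac52,3,\frac72\}$ \item $\{\frac73,\frac52,\frac{13}5,\frac83,3\}$ \item $\{\frac73,\frac{13}5,\frac83,3,\frac{10}3,4\}$ \item $\{\frac73,\frac52,\frac83,3,\frac72\}$ \item $\{\frac{17}7,\frac52,\frac83,3,\frac72\}$ \item $\{\frac52,\frac{13}5,\frac83,3,\frac{10}3,\frac{11}3,4\}$ \item $\{\frac73,\frac83,3,\frac72,4\}$ \item $\{\frac73,\frac52,\frac83,3,\frac{10}3,\frac{11}3,4\}$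 \item $\{\frac{17}7,\frac52,3,\frac72,\frac{11}3,4\}$ \item $\{\frac73,\frac52,\frac{13}5,\frac83,3,\frac{10}3,\frac{11}3,4\}$ \item $\{\frac73,\frac52,\frac83,3,\frac72,\frac{11}3,4\}$ \item $\{\frac{17}7,\frac52,\frac83,3,\frac72,\frac{11}3,4\}$ \item $\{\frac73,\frac52,\frac{13}5,\frac83,3,\frac{10}3,4\}$ \end{enumerate}
   Context: The Thue-Morse word $\mathbf{t} = t_0 t_1 t_2 \cdots = 01101001\cdots$ is the infinite fixed point, starting with $0$, of the morphism $\mu$ with $\mu(0)=01$, $\mu(1)=10$. A nonempty finite word $w$ (indexed from $0$) has period $p$, where $1 \le p \le |w|$, if $w[i]=w[i+p]$ for all $i$ with $0 \le i < |w|-p$. The smallest period of $w$ is denoted $p(w)$, and the exponent of $w$ is $\exp(w) = |w|/p(w)$. A factor of a word is a contiguous block inside it. The conjugates of a finite word $w$ are its cyclic shifts, i.e. the words $yx$ with $w = xy$ ($x,y$ possibly empty). The circular critical exponent $\mathrm{cce}(w)$ of a nonempty finite word $w$ is the supremum (maximum) of $\exp(x)$ over all nonempty factors $x$ of all conjugates of $w$. *)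

(* Defs.v *)
From mathcomp Require Import all_boot all_order all_algebra.
From mathcomp Require Import boolp classical_sets.

Set Implicit Arguments.
Unset Strict Implicit.
Unset Printing Implicit Defensive.

Import Order.TTheory GRing.Theory Num.Theory.

Local Open Scope classical_set_scope.
Local Open Scope ring_scope.

(* Letters are booleans: [false] is 0 and [true] is 1. *)
Definition tm_morph (w : seq bool) : seq bool :=
  flatten [seq if a then [:: true; false] else [:: false; true] | a <- w].

(* [iter k tm_morph [:: false]] is a prefix of length 2 ^ k of the Thue-Morse
   word, so k = n is enough to read off the letter at position n.  The lemmas
   [tm0], [tm_fixpoint] and [tm_unique] below characterize [tm] as the infinite
   fixed point of [tm_morph] that starts with 0. *)
Definition tm (n : nat) : bool := nth false (iter n tm_morph [:: false]) n.

Definition infinite_fixpoint (t : nat -> bool) : Prop :=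
  forall n, tm_morph (mkseq t n) = mkseq t n.*2.

Definition tm_factor (x : seq bool) : Prop :=
  exists i, x = mkseq (fun k => tm (i + k)%N) (size x).

Definition has_period (w : seq bool) (p : nat) : bool :=
  [&& 0 < p, p <= size w
    & all (fun i => nth false w i == nth false w (i + p))
          (iota 0 (size w - p))]%N.

(* Since 0 is not a period and [iota] starts at 0, the position returned by
   [find] is the period itself. *)
Definition min_period (w : seq bool) : nat :=
  find (has_period w) (iota 0 (size w).+1).

Definition exponent (w : seq bool) : rat :=
  (size w)%:R / (min_period w)%:R.

Definition conjugates (w : seq bool) : seq (seq bool) :=
  [seq rot i w | i <- iota 0 (size w).+1].

Definition factors (w : seq bool) : seq (seq bool) :=
  [seq take l (drop i w) | i <- iota 0 (size w), l <- iota 1 (size w - i)%N].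

(* Exponents are positive, so the default value 0 is irrelevant when w is
   nonempty. *)
Definition cce (w : seq bool) : rat :=
  \big[Num.max/0]_(c <- conjugates w) \big[Num.max/0]_(x <- factors c)
     exponent x.

Definition ace (n : nat) : set rat :=
  [set cce x | x in [set x | tm_factor x /\ size x = n]].

Definition ace_values : seq (set rat) :=
  [:: [set 1];
      [set 1; 2];
      [set 2];
      [set 2; 3];
      [set 5/2; 3];
      [set 2; 4];
      [set 7/3; 3; 7/2];
      [set 2; 3; 4];
      [set 5/2; 8/3; 3];
      [set 5/2; 3; 10/3; 4];
      [set 5/2; 3; 7/2];
      [set 7/3; 13/5; 8/3; 3];
      [set 7/3; 3; 7/2; 4];
      [set 5/2; 13/5; 8/3; 3];
      [set 5/2; 8/3; 3; 11/3; 4];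
      [set 7/3; 8/3; 3; 7/2];
      [set 7/3; 5/2; 8/3; 3];
      [set 5/2; 3; 7/2; 11/3; 4];
      [set 17/7; 5/2; 3; 7/2];
      [set 7/3; 5/2; 13/5; 8/3; 3];
      [set 7/3; 13/5; 8/3; 3; 10/3; 4];
      [set 7/3; 5/2; 8/3; 3; 7/2];
      [set 17/7; 5/2; 8/3; 3; 7/2];
      [set 5/2; 13/5; 8/3; 3; 10/3; 11/3; 4];
      [set 7/3; 8/3; 3; 7/2; 4];
      [set 7/3; 5/2; 8/3; 3; 10/3; 11/3; 4];
      [set 17/7; 5/2; 3; 7/2; 11/3; 4];
      [set 7/3; 5/2; 13/5; 8/3; 3; 10/3; 11/3; 4];
      [set 7/3; 5/2; 8/3; 3; 7/2; 11/3; 4];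
      [set 17/7; 5/2; 8/3; 3; 7/2; 11/3; 4];
      [set 7/3; 5/2; 13/5; 8/3; 3; 10/3; 4]].

Lemma nth_tm_morph w i : (i < (size w).*2)%N ->
  nth false (tm_morph w) i = odd i (+) nth false w i./2.
Proof.
elim: w i => [|a w IHw] [|[|i]] //=; try by case: a.
rewrite doubleS !ltnS negbK => lt_i.
by rewrite -IHw //; case: a.
Qed.

Lemma size_tm_morph w : size (tm_morph w) = (size w).*2.
Proof. by elim: w => [|[] w IHw] //=; rewrite doubleS -IHw. Qed.

Lemma size_iter_tm k : size (iter k tm_morph [:: false]) = (2 ^ k)%N.
Proof. by elim: k => //= k IHk; rewrite size_tm_morph IHk expnS mul2n. Qed.

Lemma nth_iter_tm k l n : (n < 2 ^ k)%N -> (n < 2 ^ l)%N ->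
  nth false (iter k tm_morph [:: false]) n =
  nth false (iter l tm_morph [:: false]) n.
Proof.
have nth0 j : nth false (iter j tm_morph [:: false]) 0 = false.
  by elim: j => //= j IHj; rewrite nth_tm_morph ?IHj // size_iter_tm double_gt0
    expn_gt0.
elim: k l n => [|k IHk] [|l] n //; rewrite ?expn0 ?ltnS ?leqn0.
- by move=> /eqP -> _; rewrite !nth0.
- by move=> _ /eqP ->; rewrite !nth0.
rewrite !expnS !mul2n => ltk ltl /=.
rewrite !nth_tm_morph ?size_iter_tm // (IHk l) //.
- by rewrite ltn_half_double.
- by rewrite ltn_half_double.
Qed.

Lemma tm0 : tm 0 = false.
Proof. by []. Qed.

Lemma tmE k n : (n < 2 ^ k)%N ->
  tm n = nth false (iter k tm_morph [:: false]) n.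
Proof.
move=> ltnk; have ltnn : (n < 2 ^ n)%N by rewrite ltn_expl.
exact: (nth_iter_tm ltnn ltnk).
Qed.

Lemma tm_half n : tm n = odd n (+) tm n./2.
Proof.
case: n => [//|n].
have lt_half : (n.+1./2 < 2 ^ n)%N.
  by rewrite ltn_half_double -mul2n -expnS ltn_expl.
rewrite (tmE lt_half) /tm iterS nth_tm_morph //.
by rewrite size_iter_tm -ltn_half_double.
Qed.

Lemma tm_fixpoint : infinite_fixpoint tm.
Proof.
move=> n; apply: (@eq_from_nth _ false).
  by rewrite size_tm_morph !size_mkseq.
move=> i; rewrite size_tm_morph size_mkseq => lt_i.
rewrite nth_tm_morph ?size_mkseq // !nth_mkseq ?ltn_half_double //.
by rewrite [RHS]tm_half.
Qed.

Lemma tm_unique t : t 0 = false -> infinite_fixpoint t -> t =1 tm.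
Proof.
move=> t0 fix_t n.
have tE k : iter k tm_morph [:: false] = mkseq t (2 ^ k).
  by elim: k => [|k IHk] /=; rewrite ?expn0 /mkseq /= ?t0 // IHk fix_t expnS mul2n.
by rewrite /tm tE nth_mkseq // ltn_expl.
Qed.

Lemma min_periodP w : w != [::] ->
  has_period w (min_period w)
  /\ forall p, has_period w p -> (min_period w <= p)%N.
Proof.
move=> w0.
have hw : has_period w (size w).
  by rewrite /has_period leqnn subnn /= andbT lt0n size_eq0.
have hs : has (has_period w) (iota 0 (size w).+1).
  by apply/hasP; exists (size w); rewrite // mem_iota /= add0n ltnS.
split=> [|p hp].
  have := nth_find 0 hs; rewrite nth_iota //.
  by rewrite -[X in (_ < X)%N](size_iota 0) -has_find.
rewrite leqNgt; apply/negP => lt_p.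
have := before_find 0 lt_p; rewrite nth_iota ?hp //.
by rewrite ltnS; case/and3P: hp.
Qed.

Lemma conjugatesP w c :
  reflect (exists x y, w = x ++ y /\ c = y ++ x) (c \in conjugates w).
Proof.
apply: (iffP mapP) => [[i _ ->]|[x [y [-> ->]]]].
  by exists (take i w), (drop i w); rewrite cat_take_drop.
exists (size x); last by rewrite rot_size_cat.
by rewrite mem_iota /= add0n ltnS size_cat leq_addr.
Qed.

Lemma factorsP w x :
  reflect (x != [::] /\ exists u v, w = u ++ x ++ v) (x \in factors w).
Proof.
apply: (iffP allpairsPdep) => [[i [l [hi hl ->]]]|[x0 [u [v ->]]]].
  move: hi hl; rewrite !mem_iota /= add0n => hi /andP[l0 hl]; split.
    rewrite -size_eq0 size_take size_drop.
    by case: ifP; rewrite -lt0n // subn_gt0.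
  by exists (take i w), (drop l (drop i w)); rewrite !cat_take_drop.
have sx : (0 < size x)%N by rewrite lt0n size_eq0.
exists (size u), (size x); split.
- by rewrite mem_iota /= add0n !size_cat -addn1 leq_add2l addn_gt0 sx.
- by rewrite mem_iota sx /= add1n ltnS !size_cat addKn leq_addr.
- by rewrite drop_size_cat // take_size_cat.
Qed.

Lemma exponent_ge0 w : 0 <= exponent w.
Proof. by rewrite divr_ge0 ?ler0n. Qed.

Lemma cce_ub w c x : c \in conjugates w -> x \in factors c ->
  exponent x <= cce w.
Proof.
move=> hc hx; pose G c := \big[Num.max/0]_(y <- factors c) exponent y.
apply: (@le_trans _ _ (G c)).
  exact: (le_bigmax_seq 0 _ predT exponent hx isT).
exact: (le_bigmax_seq 0 _ predT G hc isT).
Qed.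

Lemma cce_attained w : w != [::] ->
  exists c x, [/\ c \in conjugates w, x \in factors c & cce w = exponent x].
Proof.
move=> w0; pose P q := exists c x,
  [/\ c \in conjugates w, x \in factors c & q = exponent x].
have in_w : w \in conjugates w.
  by apply/conjugatesP; exists w, [::]; rewrite cats0.
have ww : w \in factors w.
  by apply/factorsP; split=> //; exists [::], [::]; rewrite cats0.
have PM a b : a = 0 \/ P a -> b = 0 \/ P b -> Num.max a b = 0 \/ P (Num.max a b).
  by move=> Pa Pb; rewrite /Num.max; case: ifP.
have [cce0|//] : cce w = 0 \/ P (cce w).
  rewrite /cce big_seq; elim/big_ind: _ => [|//|c hc]; first by left.
  rewrite big_seq; elim/big_ind: _ => [|//|x hx]; first by left.
  by right; exists c, x.
exists w, w; split=> //; apply/eqP.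
by rewrite eq_le (cce_ub in_w ww) cce0 exponent_ge0.
Qed.

(* Main.v *)
Require Import Defs.
From mathcomp Require Import all_boot all_order all_algebra.
From mathcomp Require Import boolp classical_sets.
From mathcomp Require Import zify.

(* Look at the junction of x = t[i..j), j = i + n, with itself.  If i and j are
   both even, or both odd with t[j-1] <> t[i], the circular word x is the image
   under the Thue-Morse morphism of a circular factor of length n/2, and the
   two have the same circular critical exponent.  Otherwise no Thue-Morse
   factor contains the 8 letters around the junction, so a repetition across it
   cannot reach far beyond one period on both sides; for n >= 32 the circular
   critical exponent is then at least 7/3 and is attained within 16 letters of
   the junction with a period at most 7.  Hence ace n is the union of ace (n/2),
   when n is even, with a set of local values that depends only on n mod 16 and
   on which pairs of 2-letter windows occur at distances n/16 and n/16 + 1.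
   These data are updated when a binary digit is appended to n, which gives a
   finite automaton whose reachable states can be enumerated. *)

Set Implicit Arguments.
Unset Strict Implicit.
Unset Printing Implicit Defensive.

Local Open Scope classical_set_scope.

(** * Repetitions and the morphism *)

Section Repetitions.
Import Order.TTheory GRing.Theory Num.Theory.

(** Words are functions of the position, so that the infinite word and the periodic extension of a
    circular word are treated alike. The period need not be minimal: larger ones do not affect a
    maximum of [l / p]. *)
Definition rep (f : nat -> bool) (s l p : nat) : Prop :=
  0 < p <= l /\ forall k, k + p < l -> f (s + k) = f (s + k + p).

Lemma rep_sub f s l p s' l' :
  rep f s l p -> s <= s' -> s' + l' <= s + l -> p <= l' -> rep f s' l' p.
Proof.
move=> [/andP[p0 pl] H] le_s le_l le_p; split; first by rewrite p0.
move=> k lt_k; have := H (s' - s + k).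
rewrite (_ : s + (s' - s + k) = s' + k); last by lia.
by apply; lia.
Qed.

Lemma rep_transport f g s s' l p :
  (forall k, k < l -> g (s' + k) = f (s + k)) -> rep f s l p -> rep g s' l p.
Proof.
move=> fg [pl H]; split=> // k lt_k.
rewrite -addnA (fg k) ?(fg (k + p)) ?addnA; try by lia.
exact: H.
Qed.

Definition blocks (f g : nat -> bool) (d : nat) : Prop :=
  forall k (b : bool), f (d + k.*2 + b) = b (+) g k.

Lemma alternating_parity (f : nat -> bool) a m :
  (forall k, k < m -> f (a + k.+1) = ~~ f (a + k)) ->
  f (a + m) = odd m (+) f a.
Proof.
elim: m => [|m IHm] H; first by rewrite addn0.
rewrite H // IHm => [|k lt_k]; first by rewrite addNb.
by apply: H; lia.
Qed.

(* If the period were odd, shifting by it would exchange the two alignments of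
   the blocks, so the last l - p letters would alternate, which an odd period
   forbids. *)
Lemma rep_blocks_even f g d s l p :
  blocks f g d -> d <= s -> p.*2 < l -> rep f s l p -> ~~ odd p.
Proof.
move=> fg le_ds lt_p [/andP[p0 pl] H]; apply/negP => op.
have blk u : d <= u -> odd u = odd d -> f u.+1 = ~~ f u.
  move=> le_u ou; have uE : u = d + (u - d)./2.*2 by lia.
  have := fg (u - d)./2 true; have := fg (u - d)./2 false.
  by rewrite /= addn0 -uE addn1 => -> ->.
have alt k : k < p -> f (s + p + k.+1) = ~~ f (s + p + k).
  move=> lt_k; have [E|E] := boolP (odd (s + p + k) == odd d).
    by rewrite addnS blk //; [lia|apply/eqP].
  have E1 := H k.+1; have E0 := H k.
  rewrite -!addnA !(addnC p) !addnA -E1 -?E0; try by lia.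
  by rewrite addnS blk //; lia.
have := alternating_parity alt; rewrite op /=.
have := H p; rewrite -addnA addnA => <-; last by lia.
have := H 0; rewrite addn0 => <-; last by lia.
by case: (f s).
Qed.

(** The preimage takes all blocks that meet the repetition, hence at most one extra letter of [f] on
    either side. An even period respects blocks, and one letter of a block determines the other. *)
Lemma rep_halve f g d s l p :
  blocks f g d -> d <= s -> p.*2 < l -> rep f s l p ->
  exists q a l', [/\ p = q.*2, rep g a l' q, l <= l'.*2 & l'.*2 <= l.+2].
Proof.
move=> fg le_ds lt_p rf; have ev := rep_blocks_even fg le_ds lt_p rf.
case: rf => /andP[p0 pl] H.
pose a := (s - d)./2; pose b := (s + l - d).-1./2.
exists p./2, a, (b - a).+1; split; try by rewrite /a /b; lia.
split; first by rewrite /a /b; lia.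
move=> k lt_k.
have key (e : bool) : s <= d + (a + k).*2 + e ->
    d + (a + k + p./2).*2 + e < s + l -> g (a + k) = g (a + k + p./2).
  move=> le_s lt_l; apply: (@addbI e); rewrite -!fg.
  have := H (d + (a + k).*2 + e - s); rewrite subnKC // => ->; last by lia.
  by congr f; lia.
(* Only the first block can start before [s], and then its second letter stands at [s]. *)
have [h|h] := leqP s (d + (a + k).*2).
  by apply: (key false); rewrite ?addn0 // /a /b in lt_k *; lia.
by apply: (key true); rewrite /a /b in lt_k h *; lia.
Qed.

Lemma tm_blocks : blocks tm tm 0.
Proof. by move=> k b; rewrite tm_half add0n; congr (_ (+) tm _); lia. Qed.

(** Descent on the period: a repetition longer than twice its period halves to another such one with
    half the period. *)
Lemma tm_overlap_free s l p : rep tm s l p -> l <= p.*2.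
Proof.
elim/ltn_ind: p s l => p IHp s l rp; rewrite leqNgt; apply/negP => lt_l.
have [q [a [l' [pE rq l1 l2]]]] := rep_halve tm_blocks (leq0n s) lt_l rp.
case: (rq) => /andP[q0 _] _.
by have := IHp q _ _ _ rq; rewrite pE; lia.
Qed.

(** * Circular critical exponents as maxima over repetitions *)

Definition quo (v : nat * nat) : rat := (v.1%:R / v.2%:R)%R.

Lemma le_quo a b : 0 < a.2 -> 0 < b.2 ->
  (quo a <= quo b)%R = (a.1 * b.2 <= b.1 * a.2).
Proof.
move=> a0 b0; rewrite /quo ler_pdivrMr ?ltr0n // mulrAC ler_pdivlMr ?ltr0n //.
by rewrite -!natrM ler_nat.
Qed.

Lemma eq_quo a b : 0 < a.2 -> 0 < b.2 ->
  (quo a == quo b)%R = (a.1 * b.2 == b.1 * a.2).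
Proof. by move=> a0 b0; rewrite eq_le !le_quo // eqn_leq. Qed.

(** Meant for [f] of period [n]: the windows of length at most [n] are then the factors of the
    conjugates of a circular word. *)
Definition is_cce (f : nat -> bool) (n : nat) (q : rat) : Prop :=
  (exists s l p, [/\ l <= n, rep f s l p & quo (l, p) = q]) /\
  (forall s l p, l <= n -> rep f s l p -> (quo (l, p) <= q)%R).

Lemma is_cce_uniq f n q r : is_cce f n q -> is_cce f n r -> q = r.
Proof.
move=> [[s [l [p [ln rp <-]]]] ubq] [[s' [l' [p' [ln' rp' <-]]]] ubr].
by apply/eqP; rewrite eq_le (ubr _ _ _ ln rp) (ubq _ _ _ ln' rp').
Qed.

Definition circ (w : seq bool) (k : nat) : bool := nth false w (k %% size w).

Lemma has_periodP w p : reflect (rep (nth false w) 0 (size w) p) (has_period w p).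
Proof.
apply: (iffP and3P) => [[p0 pl /allP H]|[/andP[p0 pl] H]]; split=> //.
- by rewrite p0.
- by move=> k lt_k; apply/eqP/H; rewrite mem_iota; lia.
- apply/allP => k; rewrite mem_iota => /andP[_ lt_k].
  by have := H k; rewrite !add0n => -> //; lia.
Qed.

Lemma nth_rot_circ w s k : k < size w ->
  nth false (rot (s %% size w) w) k = circ w (s + k).
Proof.
move=> lt_k; have lt_s : s %% size w < size w by rewrite ltn_mod; lia.
rewrite /circ -modnDml; move: (s %% size w) lt_s => r lt_r.
rewrite /rot nth_cat size_drop; case: ltnP => h.
  by rewrite nth_drop modn_small //; lia.
rewrite nth_take; last by lia.
have -> : r + k = k - (size w - r) + size w by lia.
by rewrite modnDr modn_small //; lia.
Qed.

Lemma cce_is_cce w : w != [::] -> is_cce (circ w) (size w) (cce w).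
Proof.
move=> w0; split.
  have [c [x [/mapP[i _ ->] /factorsP[x0 [u [v uv]]] ->]]] := cce_attained w0.
  have [/has_periodP px _] := min_periodP x0.
  have sz : size u + size x + size v = size w.
    by rewrite -(size_rot i w) uv !size_cat addnA.
  have [j [le_j rE]] : exists j, j < size w /\ rot i w = rot (j %% size w) w.
    have [h|h] := ltnP i (size w); first by exists i; rewrite modn_small.
    exists 0; rewrite mod0n rot0 rot_oversize //; split=> //.
    by rewrite lt0n size_eq0.
  exists (j + size u), (size x), (min_period x); split=> //.
    by rewrite -sz addnAC leq_addl.
  apply: rep_transport px => k lt_k.
  have lt_uk : size u + k < size w by rewrite -sz -addnA ltn_add2l ltn_addr.
  rewrite -addnA -nth_rot_circ // -rE uv nth_cat ltnNge leq_addr /= addKn nth_cat lt_k.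
  by rewrite add0n.
move=> s l p ln rp; have [/andP[p0 pl] _] := rp.
pose c := rot (s %% size w) w; pose x := take l c.
have sx : size x = l by rewrite size_takel // size_rot.
have x0 : x != [::] by rewrite -size_eq0 sx -lt0n (leq_trans p0).
have hx : has_period x p.
  apply/has_periodP; rewrite sx; apply: rep_transport rp => k lt_k.
  by rewrite add0n nth_take // nth_rot_circ // (leq_trans lt_k).
have [mp mle] := min_periodP x0.
have m0 : 0 < min_period x by case/and3P: mp.
apply: (@le_trans _ _ (exponent x)).
  by rewrite /exponent sx -/(quo (l, min_period x)) le_quo //= leq_mul2l mle ?orbT.
apply: (@cce_ub w c).
  apply/mapP; exists (s %% size w) => //.
  by rewrite mem_iota /= add0n ltnS ltnW // ltn_mod lt0n size_eq0.
apply/factorsP; split=> //; exists [::], (drop l c).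
by rewrite cat_take_drop.
Qed.

(** Four consecutive binary letters contain a square: two neighbours agree, or the letters
    alternate. This takes care of exponents at most 2, which [rep_halve] does not cover. *)
Lemma is_cce_ge2 f n q : 4 <= n -> is_cce f n q -> (quo (2, 1) <= q)%R.
Proof.
move=> n4 [_ ub].
have sq s p : 0 < p <= 2 -> rep f s p.*2 p -> (quo (2, 1) <= q)%R.
  move=> hp rp; apply: le_trans (ub s p.*2 p _ rp); last by lia.
  by rewrite le_quo //=; lia.
case: (boolP (f 0 == f 1)) => [/eqP e01|n01].
  by apply: (sq 0 1) => //; split=> // -[|[]].
case: (boolP (f 1 == f 2)) => [/eqP e12|n12].
  by apply: (sq 1 1) => //; split=> // -[|[]].
case: (boolP (f 2 == f 3)) => [/eqP e23|n23].
  by apply: (sq 2 1) => //; split=> // -[|[]].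
apply: (sq 0 2) => //; split=> // k lt_k; have [->|->] /= : k = 0 \/ k = 1 by lia.
  by case: (f 0) (f 1) (f 2) n01 n12 => [] [] [].
by case: (f 1) (f 2) (f 3) n12 n23 => [] [] [].
Qed.

(** Doubling a repetition of [g] keeps its exponent. Conversely, a repetition of [f] of exponent
    above 2 halves to one of at least the same exponent. *)
Lemma is_cce_blocks f g d m q : 4 <= m -> d <= m.*2 -> blocks f g d ->
  (forall k, f (k + m.*2) = f k) -> is_cce g m q -> is_cce f m.*2 q.
Proof.
move=> m4 dm fg per cg; have q2 := is_cce_ge2 m4 cg.
case: cg q2 => -[s [l [p [lm rg <-]]]] ub q2; split.
  have [/andP[p0 pl] H] := rg.
  exists (d + s.*2), l.*2, p.*2; split; first by lia.
    split; first by lia.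
    move=> k lt_k; rewrite -[k]odd_double_half in lt_k *.
    rewrite (_ : d + _ + _ = d + (s + k./2).*2 + odd k); last by lia.
    rewrite fg (_ : _ + _ + p.*2 = d + (s + k./2 + p).*2 + odd k); last by lia.
    by rewrite fg H //; lia.
  by apply/eqP; rewrite eq_quo //=; lia.
move=> s' l' p' le_l' rf; have [/andP[p0 _] _] := rf.
have [h|h] := leqP l' p'.*2.
  by apply: le_trans q2; rewrite le_quo //=; lia.
(* A full turn moves the start past the offset [d]. *)
have {}rf : rep f (s' + m.*2) l' p'.
  by apply: rep_transport rf => k _; rewrite addnAC per.
have [r [a [l1 [pE rg' le1 le2]]]] := rep_halve fg (leq_trans dm (leq_addl s' _)) h rf.
(* Completing blocks may give more than [m] letters; cutting back to [m] is harmless because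
   [l' <= m.*2]. *)
have {}rg' : rep g a (minn l1 m) r by apply: rep_sub rg' _ _ _; lia.
apply: le_trans (ub _ _ _ (geq_minr _ _) rg').
by rewrite le_quo //= ?pE; nia.
Qed.

End Repetitions.

(** * Thue-Morse windows *)

Section Windows.
Import Order.TTheory GRing.Theory Num.Theory.

Definition win (f : nat -> bool) (i l : nat) : seq bool :=
  mkseq (fun k => f (i + k)) l.

Lemma size_win f i l : size (win f i l) = l.
Proof. exact: size_mkseq. Qed.

Lemma nth_win f i l k : k < l -> nth false (win f i l) k = f (i + k).
Proof. exact: nth_mkseq. Qed.

Lemma circ_win i n k : 0 < n -> circ (win tm i n) k = tm (i + k %% n).
Proof. by move=> n0; rewrite /circ size_win nth_win // ltn_mod. Qed.

Lemma tm_morph_win i l : tm_morph (win tm i l) = win tm i.*2 l.*2.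
Proof.
apply: (@eq_from_nth _ false); first by rewrite size_tm_morph !size_win.
move=> k; rewrite size_tm_morph size_win => lt_k.
rewrite nth_tm_morph ?size_win // !nth_win //; last by lia.
by rewrite [RHS]tm_half; congr (_ (+) tm _); lia.
Qed.

Lemma iter_tm_morph_win e i l :
  iter e tm_morph (win tm i l) = win tm (2 ^ e * i) (2 ^ e * l).
Proof.
elim: e => [|e IHe]; first by rewrite !mul1n.
by rewrite iterS IHe tm_morph_win !expnS -!mul2n !mulnA.
Qed.

Definition cut (e a l : nat) (b c : bool) : seq bool :=
  take l (drop a (iter e tm_morph [:: b; c])).

(** A window inside two consecutive blocks of length [2 ^ e] depends only on its offset and on the
    two letters generating them, so short factors can be enumerated. *)
Lemma win_cut e I a l : a + l <= (2 ^ e).*2 ->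
  win tm (2 ^ e * I + a) l = cut e a l (tm I) (tm I.+1).
Proof.
move=> le_al; rewrite /cut.
have -> : [:: tm I; tm I.+1] = win tm I 2 by rewrite /win /mkseq /= addn0 addn1.
rewrite iter_tm_morph_win; apply: (@eq_from_nth _ false).
  by rewrite size_win size_takel // size_drop size_win; lia.
move=> k; rewrite size_win => lt_k.
by rewrite nth_take // nth_drop !nth_win ?addnA //; lia.
Qed.

Definition bools : seq bool := [:: false; true].

(** The parity of the position is kept because alignment depends on it; for [e > 0] it is the parity
    of the offset. *)
Definition cuts (e l : nat) : seq (bool * seq bool) :=
  undup [seq (odd a, cut e a l bc.1 bc.2) | a <- iota 0 (2 ^ e),
                                  bc <- [seq (b, c) | b <- bools, c <- bools]].

Lemma mem_cuts e i l : 0 < e -> l <= (2 ^ e).+1 ->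
  (odd i, win tm i l) \in cuts e l.
Proof.
move=> e0 le_l; rewrite mem_undup; have e2 : 0 < 2 ^ e by rewrite expn_gt0.
apply/allpairsP; exists (i %% 2 ^ e, (tm (i %/ 2 ^ e), tm (i %/ 2 ^ e).+1)).
split=> /=; first by rewrite mem_iota ltn_mod.
  by case: (tm _); case: (tm _).
rewrite -win_cut; last by have := ltn_pmod i e2; lia.
rewrite [2 ^ e * _]mulnC -divn_eq; congr pair.
by rewrite {1}(divn_eq i (2 ^ e)) oddD oddM oddX (gtn_eqF e0) andbF.
Qed.

Lemma cuts_win e l x : l <= (2 ^ e).+1 -> x \in cuts e l ->
  exists i, x.2 = win tm i l.
Proof.
move=> le_l; rewrite mem_undup => /allpairsP[[a [b c]] /= []].
rewrite mem_iota add0n => /andP[_ lt_a] _ ->.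
(* The words 11, 10, 01 and 00 occur in [tm] at positions 1, 2, 0 and 5. *)
have [I [<- <-]] : exists I, tm I = b /\ tm I.+1 = c.
  by case: b c => [] []; [exists 1|exists 2|exists 0|exists 5].
by exists (2 ^ e * I + a); rewrite win_cut //; lia.
Qed.

(** For the window from [i] to [j], the arguments are the parities of [i] and [j] and the letters
    t[j-1] and t[i], which for odd ends must form a block. *)
Definition aligned (pi pj x y : bool) : bool :=
  if pi then pj && (x != y) else ~~ pj.

Lemma tm_double m : tm m.*2 = tm m.
Proof. by rewrite tm_half odd_double doubleK. Qed.

Lemma tm_doubleS m : tm m.*2.+1 = ~~ tm m.
Proof. by rewrite tm_half /= odd_double uphalf_double. Qed.

Lemma modn_double k m (b : bool) :
  0 < m -> (k.*2 + b) %% m.*2 = (k %% m).*2 + b.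
Proof.
move=> m0; rewrite {1}(divn_eq k m) doubleD doubleMr -addnA modnMDl modn_small //.
by have := ltn_pmod k m0; case: b; lia.
Qed.

Lemma is_cce_even i m q : 4 <= m ->
  is_cce (circ (win tm i m)) m q -> is_cce (circ (win tm i.*2 m.*2)) m.*2 q.
Proof.
move=> m4; apply: (@is_cce_blocks _ _ 0) => //.
  move=> k b; rewrite !circ_win ?modn_double; try by lia.
  by rewrite -tm_blocks; congr tm; lia.
by move=> k; rewrite !circ_win ?modnDr //; lia.
Qed.

(** The window starts with the second letter of a block, so whole blocks begin at offset 1. The
    hypothesis on [tm] says that the last letter and the first one form a block across the
    junction. *)
Lemma is_cce_odd i m q : 4 <= m -> tm (i + m) = tm i ->
  is_cce (circ (win tm i.+1 m)) m q ->
  is_cce (circ (win tm i.*2.+1 m.*2)) m.*2 q.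
Proof.
move=> m4 tmE; apply: (@is_cce_blocks _ _ 1) => //; first by lia.
  move=> k b; have m0 : 0 < m by lia.
  rewrite !circ_win ?double_gt0 //; have := ltn_pmod k m0.
  case: b => /=; last first.
    rewrite (_ : 1 + _ + 0 = k.*2 + true); last by rewrite /=; lia.
    by rewrite modn_double // -[RHS]tm_double => _; congr tm; rewrite /=; lia.
  rewrite (_ : 1 + _ + 1 = k.+1.*2 + false); last by rewrite /=; lia.
  rewrite modn_double // (_ : k.+1 %% m = (k %% m).+1 %% m); last first.
    by rewrite -(addn1 k) -(addn1 (k %% m)) modnDml.
  move: (k %% m) => c.
  rewrite leq_eqVlt => /orP[/eqP cE|lt_c].
    by rewrite cE modnn !addn0 tm_doubleS -tmE; congr (~~ tm _); lia.
  by rewrite modn_small // -[RHS]tm_doubleS; congr tm; rewrite /=; lia.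
by move=> k; rewrite !circ_win ?modnDr //; lia.
Qed.

End Windows.

(** * Misaligned junctions *)

Section Local.
Import Order.TTheory GRing.Theory Num.Theory.

(** * Largest exponents by computation *)

Fixpoint maxrun (b : seq bool) : nat :=
  if b is _ :: b' then maxn (find negb b) (maxrun b') else 0.

Lemma maxrun_ub b s k : (forall i, i < k -> nth false b (s + i)) -> k <= maxrun b.
Proof.
elim: b s => [|x b IHb] [|s] H.
- by rewrite leqNgt; apply/negP => k0; have := H _ k0; rewrite nth_nil.
- by rewrite leqNgt; apply/negP => k0; have := H _ k0; rewrite nth_nil.
- rewrite leq_max; apply/orP; left; rewrite leqNgt; apply/negP => lt_k.
  have := H _ lt_k; rewrite add0n; apply/negP; apply: nth_find.
  rewrite has_find ltn_neqAle find_size andbT; apply/eqP => E.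
  by have := H _ lt_k; rewrite E nth_default.
by rewrite leq_max (IHb s) ?orbT // => i /H.
Qed.

Lemma maxrun_attained b :
  exists s, forall i, i < maxrun b -> nth false b (s + i).
Proof.
elim: b => [|x b [s IHb]]; first by exists 0.
rewrite [maxrun _]/=; case: (leqP (find negb (x :: b)) (maxrun b)) => _.
  by exists s.+1 => i /IHb.
by exists 0 => i /(before_find false) /negbFE.
Qed.

(** A run of [r] true entries is a repetition of length [r + p], since [zip] stops with the shifted
    copy. *)
Definition eqs (z : seq bool) (p : nat) : seq bool :=
  [seq x.1 == x.2 | x <- zip z (drop p z)].

Lemma nth_eqs z p k : nth false (eqs z p) k =
  (k + p < size z) && (nth false z k == nth false z (k + p)).
Proof.
have sz : size (zip z (drop p z)) = size z - p.
  by rewrite size_zip size_drop; lia.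
have [lt_k|le_k] := ltnP (k + p) (size z); last first.
  by rewrite nth_default // size_map sz; lia.
rewrite (nth_map (false, false)) ?sz; last by lia.
by rewrite nth_zip_cond sz ifT ?nth_drop /= 1?addnC //; lia.
Qed.

Lemma rep_maxrun z s l p :
  rep (nth false z) s l p -> s + l <= size z -> l <= maxrun (eqs z p) + p.
Proof.
move=> [/andP[p0 pl] H] le_sl; rewrite -leq_subLR.
rewrite leq_subLR addnC -leq_subLR; apply: (@maxrun_ub _ s) => i lt_i.
by rewrite nth_eqs H ?eqxx ?andbT; lia.
Qed.

Lemma maxrun_rep z p : 0 < p <= size z ->
  exists2 s, s + (maxrun (eqs z p) + p) <= size z &
    rep (nth false z) s (maxrun (eqs z p) + p) p.
Proof.
move=> p0; have [s H] := maxrun_attained (eqs z p).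
case: (posnP (maxrun (eqs z p))) => [->|r0].
  by exists 0; [lia|split=> [|k]; lia].
exists s.
  have := H (maxrun (eqs z p)).-1; rewrite nth_eqs => /(_ _)/andP[]; lia.
split=> [|k lt_k]; first by lia.
have /H : k < maxrun (eqs z p) by lia.
by rewrite nth_eqs => /andP[_ /eqP].
Qed.

Definition fmax (a b : nat * nat) : nat * nat :=
  if a.1 * b.2 < b.1 * a.2 then b else a.

Definition run (z : seq bool) (c p : nat) : nat * nat :=
  (minn (maxrun (eqs z p) + p) c, p).

Definition best (z : seq bool) (c P : nat) : nat * nat :=
  foldr (fun p => fmax (run z c p)) (run z c 1) (iota 2 P.-1).

Lemma bestP z c P : exists2 p, 0 < p <= maxn 1 P & best z c P = run z c p.
Proof.
rewrite /best; have : forall x, x \in iota 2 P.-1 -> 0 < x <= maxn 1 P.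
  by move=> x; rewrite mem_iota; lia.
elim: (iota _ _) => [|x r IHr] H /=; first by exists 1 => //; lia.
rewrite {1}/fmax; case: ifP => _; last by exists x; rewrite ?H ?mem_head.
by apply: IHr => y yr; apply: H; rewrite inE yr orbT.
Qed.

Lemma best_ub z c P p : 0 < p <= P ->
  (quo (run z c p) <= quo (best z c P))%R.
Proof.
have fm a b : 0 < a.2 -> 0 < b.2 -> (quo a <= quo (fmax a b))%R
    /\ (quo b <= quo (fmax a b))%R.
  by rewrite /fmax => a0 b0; case: ifP => h; rewrite !le_quo //; lia.
have pos r : 0 < (foldr (fun p => fmax (run z c p)) (run z c 1) [seq x <- r | 0 < x]).2.
  elim: r => //= x r IHr; case: ifP => //= x0.
  by rewrite /fmax; case: ifP.
move=> hp; have p0 : 0 < p by lia.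
have pE : p \in 1 :: iota 2 P.-1.
  by rewrite inE mem_iota; lia.
(* The filter removes nothing; it carries the positivity of the periods through the induction. *)
rewrite /best -(_ : [seq x <- iota 2 P.-1 | 0 < x] = iota 2 P.-1); last first.
  by apply/all_filterP/allP => x; rewrite mem_iota; lia.
move: pE; elim: (iota _ _) => [|x r IHr] /=; first by rewrite inE => /eqP ->.
rewrite !inE orbCA => /orP[/eqP pE|pr].
  rewrite -pE ifT /=; last exact: p0.
  by case: (fm (run z c p) _ p0 (pos r)).
case: ifP => x0 /=; last by apply: IHr; rewrite inE.
apply: le_trans (IHr _) _; first by rewrite inE.
by case: (fm (run z c x) _ x0 (pos r)).
Qed.

Lemma best_attained z c P : 0 < c <= size z -> P <= c ->
  exists s l p, [/\ l <= c, s + l <= size z, rep (nth false z) s l p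
                  & best z c P = (l, p)].
Proof.
move=> cz Pc; have [p hp ->] := bestP z c P.
have [|s le_s rp] := @maxrun_rep z p; first by lia.
exists s, (minn (maxrun (eqs z p) + p) c), p; split=> //; try by lia.
by apply: rep_sub rp _ _ _; lia.
Qed.

Lemma best_rep z c P s l p : rep (nth false z) s l p -> s + l <= size z ->
  l <= c -> p <= P -> (quo (l, p) <= quo (best z c P))%R.
Proof.
move=> rp le_sl lc pP; have [/andP[p0 _] _] := rp.
apply: le_trans (@best_ub z c P p _); last by lia.
rewrite le_quo //= leq_mul2r leq_min lc (rep_maxrun rp) //.
by rewrite orbT.
Qed.

(** The factors of conjugates of [w] are the factors of [w ++ w] with at most [size w] letters,
    whence the cap. *)
Lemma cce_best w : w != [::] ->
  cce w = quo (best (w ++ w) (size w) (size w)).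
Proof.
move=> w0; have n0 : 0 < size w by rewrite lt0n size_eq0.
apply: is_cce_uniq (cce_is_cce w0) _.
have nthE k : k < size w + size w -> nth false (w ++ w) k = circ w k.
  move=> lt_k; rewrite nth_cat /circ; case: ltnP => h.
    by rewrite modn_small.
  by rewrite -[in RHS](subnK h) modnDr modn_small // ltn_subLR.
split.
  have [||s [l [p [ln le_sl rp bE]]]] := @best_attained (w ++ w) (size w) (size w).
  - by rewrite size_cat n0 leq_addr.
  - by [].
  exists s, l, p; rewrite bE; split=> //.
  apply: rep_transport rp => k lt_k; rewrite nthE //.
  by rewrite -size_cat (leq_trans _ le_sl) // ltn_add2l.
move=> s l p ln rp.
have lt_s := ltn_pmod s n0.
apply: (@best_rep _ _ _ (s %% size w)) => //; last first.
- by case: rp => /andP[_ pl] _; apply: leq_trans pl ln.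
- by rewrite size_cat leq_add // ltnW.
apply: rep_transport rp => k lt_k.
have lt_sk : s %% size w + k < size w + size w.
  by rewrite -addnS leq_add // ?(ltnW lt_s) // (leq_trans lt_k).
rewrite nthE //.
by rewrite /circ modnDml.
Qed.

(** * Letters around the junction *)

Definition junction_aligned (x y : bool * seq bool) : bool :=
  aligned y.1 (odd (size x.2) (+) x.1) (last false x.2) (head false y.2).

Lemma junction_alignedE i n l : 0 < l <= n ->
  junction_aligned (odd (i + n - l), win tm (i + n - l) l) (odd i, win tm i l) =
  aligned (odd i) (odd (i + n)) (tm (i + n).-1) (tm i).
Proof.
move=> le_ln; rewrite /junction_aligned; cbn [fst snd].
rewrite size_win -nth_last -nth0 size_win !nth_win ?addn0; try by lia.
by congr (aligned _ _ (tm _) _); lia.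
Qed.

(** All pairs of windows of length 4 are tried, whatever their distance. Hence no repetition can
    carry the 8 letters around a misaligned junction into [tm]. *)
Lemma small_junction :
  let F := [seq x.2 | x <- cuts 3 8] in
  all (fun x => all (fun y => ~~ junction_aligned x y ==> (x.2 ++ y.2 \notin F))
                    (cuts 2 4)) (cuts 2 4).
Proof. by vm_compute. Qed.

(** The periods 8 to 17 are those that the length bounds in [period_lt8] leave open; 40 letters are
    20 on each side of the junction. *)
Definition short_runs (z : seq bool) : bool :=
  all (fun p => 3 * (run z 40 p).1 <= 7 * p) (iota 8 10).

Lemma long_junction :
  let C := cuts 5 20 in
  all (fun x => all (fun y => if junction_aligned x y then true
                              else short_runs (x.2 ++ y.2)) C) C.
Proof. by vm_compute. Qed.

Definition junction (i n l : nat) : seq bool :=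
  win tm (i + n - l) l ++ win tm i l.

Lemma nth_junction i n l k : l <= n -> k < l.*2 ->
  nth false (junction i n l) k = circ (win tm i n) (n - l + k).
Proof.
move=> le_ln lt_k; have n0 : 0 < n by lia.
rewrite nth_cat size_win circ_win //; case: ltnP => h.
  by rewrite nth_win // modn_small; [congr tm|]; lia.
rewrite nth_win; last by lia.
have -> : n - l + k = k - l + n by lia.
by rewrite modnDr modn_small //; lia.
Qed.

Lemma size_junction i n l : size (junction i n l) = l.*2.
Proof. by rewrite size_cat !size_win addnn. Qed.

Lemma rep_junction i n l s l' p : l <= n ->
  n - l <= s -> s + l' <= n + l -> rep (circ (win tm i n)) s l' p ->
  rep (nth false (junction i n l)) (s - (n - l)) l' p.
Proof.
move=> le_ln le_s le_sl; apply: rep_transport => k lt_k.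
by rewrite nth_junction; [congr circ| |]; lia.
Qed.

Section Misaligned.
Variables i n : nat.
Hypothesis n32 : 32 <= n.
Hypothesis misaligned :
  ~~ aligned (odd i) (odd (i + n)) (tm (i + n).-1) (tm i).
Let f := circ (win tm i n).

Let fE k : k < n -> f k = tm (i + k).
Proof. by move=> lt_k; rewrite /f circ_win ?modn_small //; lia. Qed.

Let fnE k : k < n -> f (n + k) = tm (i + k).
Proof. by move=> lt_k; rewrite /f circ_win ?modnDl ?modn_small //; lia. Qed.

(** Left of the junction the repetition lies in [tm], where more than [2 * p] letters would be an
    overlap. *)
Let left_bound s l p : s < n -> n <= s + l -> rep f s l p -> n - s <= p.*2.
Proof.
move=> lt_s le_n rp; have [/andP[p0 _] _] := rp.
rewrite leqNgt; apply/negP => lt_p.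
suff /tm_overlap_free : rep tm (i + s) (n - s) p by lia.
have {}rp : rep f s (n - s) p by apply: rep_sub rp _ _ _; lia.
by apply: rep_transport rp => k lt_k; rewrite fE ?addnA //; lia.
Qed.

Let right_bound s l p :
  s <= n -> n <= s + l -> l <= n -> rep f s l p -> s + l - n <= p.*2.
Proof.
move=> lt_s le_n ln rp; have [/andP[p0 _] _] := rp.
rewrite leqNgt; apply/negP => lt_p.
suff /tm_overlap_free : rep tm i (s + l - n) p by lia.
have {}rp : rep f n (s + l - n) p by apply: rep_sub rp _ _ _; lia.
by apply: rep_transport rp => k lt_k; rewrite fnE //; lia.
Qed.

Let not_tm a : junction i n 4 = win tm a 8 -> False.
Proof.
move=> E; have /allP/(_ _ (@mem_cuts 2 (i + n - 4) 4 isT isT)) := small_junction.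
move=> /allP/(_ _ (@mem_cuts 2 i 4 isT isT)).
rewrite junction_alignedE ?(negPf misaligned); last by lia.
rewrite implyTb; cbn [snd]; rewrite -/(junction i n 4) E => /negP; apply.
by apply/mapP; exists (odd a, win tm a 8) => //; apply: mem_cuts.
Qed.

(* A repetition that reaches 4 letters beyond a full period on one side of the
   junction moves the 8 letters around the junction inside the Thue-Morse
   word, where they do not occur. *)
Let left_short s l p : s < n -> n + 4 <= s + l -> l <= n -> 4 <= p ->
  rep f s l p -> n - s <= p + 3.
Proof.
move=> lt_s le_n ln p4 [_ H]; rewrite leqNgt; apply/negP => lt_p.
apply: (@not_tm (i + (n - 4 - p))); apply: (@eq_from_nth _ false).
  by rewrite size_junction size_win.
move=> k; rewrite size_junction => lt_k.
rewrite nth_junction ?nth_win // -?/f; try by lia.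
have := H (n - 4 - p - s + k).
rewrite (_ : s + _ = n - 4 - p + k); last by lia.
rewrite (_ : n - 4 - p + k + p = n - 4 + k); last by lia.
by move=> <-; rewrite ?fE ?addnA //; lia.
Qed.

Let right_short s l p : s + 4 <= n -> n <= s + l -> l <= n -> 4 <= p ->
  rep f s l p -> s + l - n <= p + 3.
Proof.
move=> lt_s le_n ln p4 [_ H]; rewrite leqNgt; apply/negP => lt_p.
apply: (@not_tm (i + (p - 4))); apply: (@eq_from_nth _ false).
  by rewrite size_junction size_win.
move=> k; rewrite size_junction => lt_k.
rewrite nth_junction ?nth_win // -?/f; try by lia.
have := H (n - 4 - s + k).
rewrite (_ : s + _ = n - 4 + k); last by lia.
rewrite (_ : n - 4 + k + p = n + (p - 4 + k)); last by lia.
by move=> ->; rewrite ?fnE ?addnA //; lia.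
Qed.

Let period_lt8 s l p :
  s < n -> n < s + l -> l <= n -> 7 * p < 3 * l -> rep f s l p -> p < 8.
Proof.
move=> lt_s lt_n ln lt_p rp; rewrite ltnNge; apply/negP => p8.
(* The least length of exponent above 7/3. The repetition is cut down to it, keeping a letter on
   each side of the junction. *)
pose L := (7 * p) %/ 3 + 1.
have [s' [s1 s2 rp']] : exists s', [/\ s' < n, n < s' + L & rep f s' L p].
  have [h|h] := leqP (n - s) (L - 1).
    exists s; split; [by []|by rewrite /L in h *; lia|].
    by apply: rep_sub rp _ _ _; rewrite /L in h *; lia.
  exists (n - (L - 1)); split; try by rewrite /L; lia.
  by apply: rep_sub rp _ _ _; rewrite /L in h *; lia.
have Ln : L <= n by rewrite /L; lia.
have b1 := left_bound s1 (ltnW s2) rp'.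
have b2 := right_bound (ltnW s1) (ltnW s2) Ln rp'.
(* If one side has at most 3 letters, then [L <= 2 * p + 3], so [p <= 8]. Otherwise both sides have
   at most [p + 3] letters, so [L <= 2 * p + 6] and [p <= 17]. *)
have [h1 h2 h3] : [/\ p <= 17, n - s' <= 20 & s' + L - n <= 20].
  have [l1|l1] := leqP (n - s') 3; first by rewrite /L in s2 b1 b2 *; split; lia.
  have [l2|l2] := leqP (s' + L - n) 3.
    by rewrite /L in s2 b1 b2 l2 *; split; lia.
  have c1 : n - s' <= p + 3 by apply: left_short rp'; lia.
  have c2 : s' + L - n <= p + 3 by apply: right_short rp'; lia.
  by rewrite /L in s2 c1 c2 *; split; lia.
have /allP/(_ _ (@mem_cuts 5 (i + n - 20) 20 isT isT)) := long_junction.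
move=> /allP/(_ _ (@mem_cuts 5 i 20 isT isT)).
rewrite junction_alignedE ?(negPf misaligned); last by lia.
cbn [snd]; rewrite -/(junction i n 20) => /allP/(_ p).
have rz := @rep_junction i n 20 _ _ _ _ _ _ rp'.
have := rep_maxrun (rz _ _ _); rewrite size_junction mem_iota /=.
rewrite /L in h3 *; lia.
Qed.

(** A repetition of exponent above 7/3 crosses the junction, because [tm] is overlap-free, and has
    period at most 7. By the bound [2 * p] on each side it stays within 14 letters of the
    junction. *)
Lemma is_cce_misaligned :
  let b := best (junction i n 16) 32 7 in
  (quo (7, 3) <= quo b)%R -> is_cce f n (quo b).
Proof.
move=> b b73; split.
  have [|//|s [l [p [lc le_sl rp bE]]]] := @best_attained (junction i n 16) 32 7.
    by rewrite size_junction.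
  rewrite size_junction in le_sl.
  exists (n - 16 + s), l, p; split; [by lia| |by rewrite /b bE].
  apply: rep_transport rp => k lt_k.
  by rewrite nth_junction ?addnA //; lia.
move=> s l p ln rp; have [/andP[p0 pl] _] := rp.
have n0 : 0 < n by lia.
have [h|h] := leqP (3 * l) (7 * p).
  by apply: le_trans b73; rewrite le_quo //=; lia.
wlog lt_s : s rp / s < n => [hwlog|].
  apply: (hwlog (s %% n)); last exact: ltn_pmod.
  by apply: rep_transport rp => k _; rewrite /f !circ_win // modnDml.
have [le_n|lt_n] := leqP (s + l) n.
  suff /tm_overlap_free : rep tm (i + s) l p by lia.
  by apply: rep_transport rp => k lt_k; rewrite fE ?addnA //; lia.
have p8 := period_lt8 lt_s lt_n ln h rp.
have b1 := left_bound lt_s (ltnW lt_n) rp.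
have b2 := right_bound (ltnW lt_s) (ltnW lt_n) ln rp.
by apply: best_rep (rep_junction _ _ _ rp) _ _ _; rewrite ?size_junction; lia.
Qed.

End Misaligned.

End Local.

(** * The recursion for ace *)

Section Recursion.
Import Order.TTheory GRing.Theory Num.Theory.

Lemma aceP n x : 0 < n -> ace n x <-> exists i, x = cce (win tm i n).
Proof.
move=> n0; split=> [[w /= [[i wE] sw] <-]|[i ->]].
  by exists i; rewrite wE sw.
by exists (win tm i n) => //=; rewrite size_win; split=> //; exists i; rewrite size_win.
Qed.

Lemma win_neq0 f i n : 0 < n -> win f i n != [::].
Proof. by rewrite -size_eq0 size_win lt0n. Qed.

Lemma cce_win i n q : 0 < n -> is_cce (circ (win tm i n)) n q -> cce (win tm i n) = q.
Proof.
move=> n0; apply: is_cce_uniq.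
by have := cce_is_cce (win_neq0 tm i n0); rewrite size_win.
Qed.

Lemma is_cce_win i n : 0 < n -> is_cce (circ (win tm i n)) n (cce (win tm i n)).
Proof. by move=> n0; have := cce_is_cce (win_neq0 tm i n0); rewrite size_win. Qed.

Definition misaligned (i n : nat) : bool :=
  ~~ aligned (odd i) (odd (i + n)) (tm (i + n).-1) (tm i).

(** An aligned window is, circularly, the image of a window of half the length; conversely, every
    such window doubles to an aligned one at an even position. The bound 8 leaves halves of length
    at least 4, as [is_cce_ge2] requires. *)
Lemma ace_rec n x : 8 <= n -> ace n x <->
  ~~ odd n /\ ace n./2 x \/ exists2 i, misaligned i n & x = cce (win tm i n).
Proof.
move=> n8; have n0 : 0 < n by lia.
have h0 : 0 < n./2 by lia.
have h4 : 4 <= n./2 by lia.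
rewrite !aceP //; split.
  move=> [i ->]; case: (boolP (misaligned i n)) => [|/negPn]; first by right; exists i.
  move=> al; left; rewrite /aligned in al; case: ifP al => [oi /andP[oj neq]|ei ej].
    have ev : ~~ odd n by lia.
    split=> //; exists i./2.+1.
    rewrite -[in LHS](odd_double_half i) -[in LHS](even_halfK ev) oi add1n.
    apply: cce_win; first by rewrite double_gt0.
    apply: is_cce_odd; rewrite ?is_cce_win //; last exact: is_cce_win.
    (* Position [i + n - 1] is even and [i] is odd, so the letters there differ exactly when their
       preimages agree. *)
    move: neq; rewrite (_ : (i + n).-1 = (i./2 + n./2).*2); last by lia.
    have -> : tm i = ~~ tm i./2 by rewrite -tm_doubleS; congr tm; lia.
    by rewrite tm_double; case: (tm i./2); case: tm.
  have ev : ~~ odd n by lia.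
  split=> //; exists i./2.
  have ei' : ~~ odd i by rewrite ei.
  rewrite -[in LHS](even_halfK ei') -[in LHS](even_halfK ev).
  apply: cce_win; first by rewrite double_gt0.
  by apply: is_cce_even => //; apply: is_cce_win.
move=> [[ev [i ->]]|[i _ ->]]; last by exists i.
exists i.*2; rewrite -[in RHS](even_halfK ev); apply/esym.
apply: cce_win; first by rewrite double_gt0.
by apply: is_cce_even => //; apply: is_cce_win.
Qed.

Definition vals : seq (nat * nat) :=
  [:: (1, 1); (2, 1); (7, 3); (17, 7); (5, 2); (13, 5);
      (8, 3); (3, 1); (10, 3); (7, 2); (11, 3); (4, 1)].

(** The default [v] preserves a fraction missing from [vals], so [quo_norm] needs no membership. *)
Definition norm (v : nat * nat) : nat * nat :=
  nth v vals (find (fun w => v.1 * w.2 == w.1 * v.2) vals).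

Lemma vals_pos v : v \in vals -> 0 < v.2.
Proof.
have /allP H : all (fun v => 0 < v.2) vals by [].
exact: H.
Qed.

Lemma quo_norm v : 0 < v.2 -> quo (norm v) = quo v.
Proof.
move=> v0; rewrite /norm; set F := fun w => _.
have [h|h] := boolP (has F vals); last by rewrite nth_default // leqNgt -has_find.
have /eqP E := nth_find v h; apply/eqP; rewrite eq_quo //.
  by rewrite -E.
by apply: vals_pos; rewrite mem_nth // -has_find.
Qed.

Definition qset (S : seq (nat * nat)) : set rat :=
  [set x | exists2 v, v \in S & x = quo v].

(** Filtering the fixed list gives equal sets equal codes. Entries outside [vals] would be lost,
    hence the membership checks. *)
Definition sort_vals (S : seq (nat * nat)) : seq (nat * nat) :=
  [seq v <- vals | v \in S].

Lemma mem_sort_vals S v : {subset S <= vals} -> (v \in sort_vals S) = (v \in S).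
Proof. by move=> sS; rewrite mem_filter andb_idr //; apply: sS. Qed.

Lemma sort_vals_sub S : {subset sort_vals S <= vals}.
Proof. by move=> v; rewrite mem_filter => /andP[]. Qed.

(** * Pairs of two-letter windows at a given distance *)

Definition quad := ((bool * bool) * (bool * bool))%type.

Definition quad_at (I J : nat) : quad := ((tm I, tm I.+1), (tm J, tm J.+1)).

(** [I] is the block of length 16 where a window starts, [J] the one where its last 16 letters
    start. Stepping back by these 16 letters causes the shift in [J.+1 = I + N]. *)
Definition quads (N : nat) (Q : seq quad) : Prop :=
  forall q, q \in Q <-> exists I J, J.+1 = I + N /\ q = quad_at I J.

Definition all_quads : seq quad :=
  [seq (p, q) | p <- [seq (b, c) | b <- bools, c <- bools],
                q <- [seq (b, c) | b <- bools, c <- bools]].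

Lemma mem_all_quads q : q \in all_quads.
Proof. by case: q => [[[] []] [[] []]]. Qed.

Definition quads_of (s : seq quad) : seq quad := [seq q <- all_quads | q \in s].

Lemma mem_quads_of s q : (q \in quads_of s) = (q \in s).
Proof. by rewrite mem_filter mem_all_quads andbT. Qed.

(** The two lists treat even and odd [I]: a pair at an even position is a block, a pair at an odd
    one straddles two blocks. *)
Definition even_quads (Q : seq quad) : seq quad :=
  quads_of ([seq ((q.1.1, ~~ q.1.1), (~~ q.2.1, q.2.2)) | q <- Q] ++
            [seq ((~~ q.1.1, q.1.2), (q.2.2, ~~ q.2.2)) | q <- Q]).

(** For odd [I] the halved positions are one step farther apart than for even [I], hence [Q']. *)
Definition odd_quads (Q Q' : seq quad) : seq quad :=
  quads_of ([seq ((q.1.1, ~~ q.1.1), (q.2.2, ~~ q.2.2)) | q <- Q] ++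
            [seq ((~~ q.1.1, q.1.2), (~~ q.2.1, q.2.2)) | q <- Q']).

Lemma quads_even N Q : 0 < N -> quads N Q -> quads N.*2 (even_quads Q).
Proof.
move=> N0 HQ q; rewrite mem_quads_of mem_cat; split.
  case/orP => /mapP[_ /HQ[I [J [E ->]]] ->] /=.
    exists I.*2, J.*2.+1; split; first by lia.
    by rewrite /quad_at -doubleS !tm_doubleS !tm_double.
  exists I.*2.+1, J.+1.*2; split; first by lia.
  by rewrite /quad_at -!doubleS !tm_doubleS !tm_double.
move=> [I [J [E ->]]]; pose I' := I./2; pose J' := (I' + N).-1.
have hq : quad_at I' J' \in Q by apply/HQ; exists I', J'; rewrite /J'; split=> //; lia.
have [oI|eI] := boolP (odd I); apply/orP; [right|left];
  apply/mapP; exists (quad_at I' J') => //.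
  have -> : I = I'.*2.+1 by rewrite /I'; lia.
  have -> : J = J'.+1.*2 by rewrite /J' /I'; lia.
  by rewrite /quad_at -!doubleS !tm_doubleS !tm_double.
have -> : I = I'.*2 by rewrite /I'; lia.
have -> : J = J'.*2.+1 by rewrite /J' /I'; lia.
by rewrite /quad_at -!doubleS !tm_doubleS !tm_double.
Qed.

Lemma quads_odd N Q Q' : 0 < N -> quads N Q -> quads N.+1 Q' ->
  quads N.*2.+1 (odd_quads Q Q').
Proof.
move=> N0 HQ HQ' q; rewrite mem_quads_of mem_cat; split.
  case/orP => [/mapP[_ /HQ[I [J [E ->]]] ->]|/mapP[_ /HQ'[I [J [E ->]]] ->]] /=.
    exists I.*2, J.+1.*2; split; first by lia.
    by rewrite /quad_at !tm_doubleS !tm_double.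
  exists I.*2.+1, J.*2.+1; split; first by lia.
  by rewrite /quad_at -!doubleS !tm_doubleS !tm_double.
move=> [I [J [E ->]]]; pose I' := I./2.
have [oI|eI] := boolP (odd I); apply/orP; [right|left]; apply/mapP.
  have hq : quad_at I' (I' + N) \in Q'.
    by apply/HQ'; exists I', (I' + N); rewrite addnS.
  exists (quad_at I' (I' + N)) => //.
  have -> : I = I'.*2.+1 by rewrite /I'; lia.
  have -> : J = (I' + N).*2.+1 by rewrite /I'; lia.
  by rewrite /quad_at -!doubleS !tm_doubleS !tm_double.
have hq : quad_at I' (I' + N).-1 \in Q.
  by apply/HQ; exists I', (I' + N).-1; split=> //; lia.
exists (quad_at I' (I' + N).-1) => //.
have -> : I = I'.*2 by rewrite /I'; lia.
have -> : J = (I' + N).-1.+1.*2 by rewrite /I'; lia.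
by rewrite /quad_at !tm_doubleS !tm_double.
Qed.

Definition quads1 : seq quad :=
  quads_of [seq (p, p) | p <- [seq (b, c) | b <- bools, c <- bools]].

Lemma quads1P : quads 1 quads1.
Proof.
move=> q; rewrite mem_quads_of; split=> [/mapP[[b c] _ ->]|[I [J [E ->]]]].
  have [I IE] : exists I, (b, c) = (tm I, tm I.+1).
    by case: b c => [] []; [exists 1|exists 2|exists 0|exists 5].
  by exists I, I; rewrite addn1 /quad_at -IE.
have -> : J = I by lia.
by rewrite /quad_at; case: (tm I); case: (tm I.+1).
Qed.

(** Aligned junctions contribute nothing here: their values come from [ace n./2]. *)
Definition local_vals (q : quad) (a r : nat) : seq (nat * nat) :=
  let u := cut 4 r 16 q.2.1 q.2.2 in
  let v := cut 4 a 16 q.1.1 q.1.2 in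
  if junction_aligned (odd r, u) (odd a, v) then [::]
  else [:: norm (best (u ++ v) 32 7)].

(** An exhaustive check over all quadruples and offsets; the bound 7/3 supplies the hypothesis of
    [is_cce_misaligned]. *)
Lemma local_vals_ok q a r v : a < 16 -> r < 16 -> v \in local_vals q a r ->
  v \in vals /\ 7 * v.2 <= 3 * v.1.
Proof.
have H : all (fun q => all (fun a => all (fun r =>
    all (fun v => (v \in vals) && (7 * v.2 <= 3 * v.1)) (local_vals q a r))
  (iota 0 16)) (iota 0 16)) all_quads by vm_compute.
move=> lt_a lt_r hv; apply/andP.
move/allP: H => /(_ _ (mem_all_quads q))/allP/(_ a).
by rewrite mem_iota => /(_ lt_a)/allP/(_ r); rewrite mem_iota => /(_ lt_r)/allP/(_ _ hv).
Qed.

Lemma best_pos z c P : 0 < (best z c P).2.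
Proof. by have [p /andP[p0 _] ->] := bestP z c P. Qed.

Lemma local_valsP n I J a r i x : 32 <= n -> a < 16 -> r < 16 ->
  i = 16 * I + a -> i + n - 16 = 16 * J + r ->
  qset (local_vals (quad_at I J) a r) x <->
  misaligned i n /\ x = cce (win tm i n).
Proof.
move=> n32 lt_a lt_r iE jE.
have n0 : 0 < n by lia.
have lv_ok := @local_vals_ok (quad_at I J) a r _ lt_a lt_r.
have uE : cut 4 r 16 (tm J) (tm J.+1) = win tm (i + n - 16) 16.
  by rewrite jE -(@win_cut 4) //; lia.
have vE : cut 4 a 16 (tm I) (tm I.+1) = win tm i 16.
  by rewrite iE -(@win_cut 4) //; lia.
have alE : junction_aligned (odd r, win tm (i + n - 16) 16) (odd a, win tm i 16)
    = ~~ misaligned i n.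
  rewrite negbK -(@junction_alignedE _ _ 16); last by lia.
  by congr (junction_aligned (_, _) (_, _)); lia.
rewrite /local_vals /= uE vE alE if_neg in lv_ok *.
case: (boolP (misaligned i n)) lv_ok => [mis|_] ok; last first.
  by split=> [[v]|[]].
have cce_b := is_cce_misaligned n32 mis.
move: (best _ 32 7) (best_pos (junction i n 16) 32 7) ok cce_b => b b0 ok cce_b.
have [nb b73] := ok _ (mem_head _ _).
have -> : cce (win tm i n) = quo (norm b).
  rewrite quo_norm //; apply: (cce_win n0); apply: cce_b.
  by rewrite -(quo_norm b0) le_quo ?(vals_pos nb) //= [_ * 3]mulnC.
split=> [[v]|[_ ->]]; first by rewrite inE => /eqP ->.
by exists (norm b); rewrite ?mem_head.
Qed.

(** For length [16 * N + s] the last 16 letters start at offset [a + s], minus 16 after a carry.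
    Without a carry the two blocks are related as in [quads N], with one as in [quads N.+1]. *)
Definition low_vals (q : quad) (s : nat) : seq (nat * nat) :=
  sort_vals (flatten [seq local_vals q a (a + s) | a <- iota 0 (16 - s)]).

Definition high_vals (q : quad) (s : nat) : seq (nat * nat) :=
  sort_vals (flatten [seq local_vals q a (a + s - 16) | a <- iota (16 - s) s]).

Definition vals_table : seq (seq (seq (nat * nat) * seq (nat * nat))) :=
  Eval vm_compute in
  [seq [seq (low_vals q s, high_vals q s) | s <- iota 0 16] | q <- all_quads].

Definition table_vals (q : quad) (s : nat) : seq (nat * nat) * seq (nat * nat) :=
  nth ([::], [::]) (nth [::] vals_table (index q all_quads)) s.

Lemma nth_table (A : eqType) (B : Type) (x0 : B) (f : A -> nat -> B) r n a k :
  a \in r -> k < n ->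
  nth x0 (nth [::] [seq [seq f b j | j <- iota 0 n] | b <- r] (index a r)) k = f a k.
Proof.
move=> ra lt_k; rewrite (nth_map a) ?index_mem // nth_index //.
by rewrite (nth_map 0) ?size_iota // nth_iota.
Qed.

Lemma vals_tableE : vals_table =
  [seq [seq (low_vals q s, high_vals q s) | s <- iota 0 16] | q <- all_quads].
Proof. by vm_compute. Qed.

Lemma table_valsE q s : s < 16 -> table_vals q s = (low_vals q s, high_vals q s).
Proof.
rewrite /table_vals vals_tableE => lt_s.
by rewrite (nth_table _ (fun q s => (low_vals q s, high_vals q s))) // mem_all_quads.
Qed.

Definition misaligned_vals (Q Q' : seq quad) (s : nat) : seq (nat * nat) :=
  sort_vals (flatten [seq (table_vals q s).1 | q <- Q] ++
         flatten [seq (table_vals q s).2 | q <- Q']).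

Lemma misaligned_valsP N s Q Q' x : 2 <= N -> s < 16 ->
  quads N Q -> quads N.+1 Q' ->
  qset (misaligned_vals Q Q' s) x <->
  exists2 i, misaligned i (16 * N + s) & x = cce (win tm i (16 * N + s)).
Proof.
move=> N2 lt_s HQ HQ'; have n32 : 32 <= 16 * N + s by lia.
rewrite /misaligned_vals; split.
  move=> [v]; rewrite mem_filter => /andP[+ _] ->.
  rewrite mem_cat => /orP[] /flatten_mapP[q]; rewrite table_valsE //=.
    move=> /HQ[I [J [E ->]]]; rewrite mem_filter => /andP[/flatten_mapP[a]].
    rewrite mem_iota => lt_a va _.
    have [] := @local_valsP (16 * N + s) I J a (a + s) (16 * I + a) (quo v) n32;
      try by lia.
    by case=> [|mis xE]; [exists v|move=> _; exists (16 * I + a)].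
  move=> /HQ'[I [J [E ->]]]; rewrite mem_filter => /andP[/flatten_mapP[a]].
  rewrite mem_iota => lt_a va _.
  have [] := @local_valsP (16 * N + s) I J a (a + s - 16) (16 * I + a) (quo v) n32;
    try by lia.
  by case=> [|mis xE]; [exists v|move=> _; exists (16 * I + a)].
move=> [i mis xE]; pose I := i %/ 16; pose a := i %% 16.
have iE : i = 16 * I + a by rewrite /I /a; lia.
have lt_a : a < 16 by rewrite ltn_mod.
have [lt_as|le_as] := ltnP (a + s) 16.
  have [_ []] := @local_valsP (16 * N + s) I (I + N).-1 a (a + s) i x n32 lt_a
    lt_as iE (ltac:(lia)); first by split.
  move=> v va ->; exists v => //.
  have [vv _] := local_vals_ok lt_a lt_as va.
  rewrite mem_filter vv andbT mem_cat; apply/orP; left.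
  apply/flatten_mapP; exists (quad_at I (I + N).-1).
    by apply/HQ; exists I, (I + N).-1; split=> //; lia.
  rewrite table_valsE //= mem_filter vv andbT; apply/flatten_mapP; exists a => //.
  by rewrite mem_iota; lia.
have lt_as : a + s - 16 < 16 by lia.
have [_ []] := @local_valsP (16 * N + s) I (I + N) a (a + s - 16) i x n32 lt_a
  lt_as iE (ltac:(lia)); first by split.
move=> v va ->; exists v => //.
have [vv _] := local_vals_ok lt_a lt_as va.
rewrite mem_filter vv andbT mem_cat; apply/orP; right.
apply/flatten_mapP; exists (quad_at I (I + N)).
  by apply/HQ'; exists I, (I + N); rewrite addnS.
rewrite table_valsE //= mem_filter vv andbT; apply/flatten_mapP; exists a => //.
by rewrite mem_iota; lia.
Qed.

End Recursion.

(** * The automaton *)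

Section Automaton.
Import Order.TTheory GRing.Theory Num.Theory.

(** Brute force below 32, the length from which [is_cce_misaligned] applies. *)
Definition base (n : nat) : seq (nat * nat) :=
  sort_vals [seq norm (best (w ++ w) n n) | w <- undup [seq x.2 | x <- cuts 5 n]].

Definition base_table : seq (seq (nat * nat)) := Eval vm_compute in mkseq base 32.

Lemma base_tableE : base_table = mkseq base 32.
Proof. by vm_compute. Qed.

Definition base_vals (n : nat) : seq (nat * nat) := nth [::] base_table n.

Lemma base_valsE n : n < 32 -> base_vals n = base n.
Proof. by rewrite /base_vals base_tableE; apply: nth_mkseq. Qed.

Lemma mem_vals_base n w : 0 < n < 32 -> w \in [seq x.2 | x <- cuts 5 n] ->
  norm (best (w ++ w) n n) \in vals.
Proof.
have H : all (fun n => all (fun w => norm (best (w ++ w) n n) \in vals)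
    (undup [seq x.2 | x <- cuts 5 n])) (iota 1 31) by vm_compute.
move=> lt_n hw; move/allP: H => /(_ n); rewrite mem_iota => /(_ lt_n)/allP.
by apply; rewrite mem_undup.
Qed.

Lemma base_ace n x : 0 < n < 32 -> ace n x <-> qset (base_vals n) x.
Proof.
move=> hn; have /andP[n0 n32] := hn; rewrite aceP // base_valsE //.
have wE i : cce (win tm i n) = quo (norm (best (win tm i n ++ win tm i n) n n)).
  by rewrite quo_norm ?best_pos // cce_best ?win_neq0 // size_win.
split=> [[i ->]|[v]].
  have hw : win tm i n \in [seq x.2 | x <- cuts 5 n].
    apply/mapP; exists (odd i, win tm i n) => //.
    by apply: mem_cuts => //; apply: leq_trans (ltnW n32) _.
  exists (norm (best (win tm i n ++ win tm i n) n n)); last exact: wE.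
  rewrite mem_filter mem_vals_base // andbT; apply/mapP.
  by exists (win tm i n); rewrite ?mem_undup.
rewrite mem_filter => /andP[/mapP[w + ->] _].
rewrite mem_undup => /mapP[y hy ->] ->.
have [|i ->] := @cuts_win 5 n y _ hy; first by apply: leq_trans (ltnW n32) _.
by exists i; rewrite wE.
Qed.

(** Only the residue of the length modulo 16 is recorded, and the lists in reachable states are
    filtered from fixed finite ones, so the automaton is finite. *)
Definition state := ((seq quad * seq quad) * (nat * seq (nat * nat)))%type.

Definition describes (n : nat) (st : state) : Prop :=
  [/\ quads (n %/ 16) st.1.1, quads (n %/ 16).+1 st.1.2, st.2.1 = n %% 16 &
      forall x, ace n x <-> qset st.2.2 x].

(** With [n = 16 * N + s], the quotient of [2 * n + b] by 16 is [2 * N] or [2 * N + 1] according to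
    whether [s < 8]. Old values survive only for [b = 0], as aligned junctions need an even
    length. *)
Definition step (st : state) (b : bool) : state :=
  let Q := st.1.1 in let Q' := st.1.2 in
  let P := if st.2.1 < 8 then (even_quads Q, odd_quads Q Q')
           else (odd_quads Q Q', even_quads Q') in
  let s := st.2.1.*2 %% 16 + b in
  (P, (s, sort_vals (misaligned_vals P.1 P.2 s ++ if b then [::] else st.2.2))).

Lemma describes_step n st (b : bool) : 16 <= n -> {subset st.2.2 <= vals} ->
  describes n st -> describes (n.*2 + b) (step st b).
Proof.
case: st => [[Q Q'] [s S]] /= n16 subS [/= HQ HQ' sE aS].
have N0 : 0 < n %/ 16 by lia.
have sb : s.*2 %% 16 + b = (n.*2 + b) %% 16 by rewrite sE; case: b; lia.
rewrite /step /=; set P := if _ then _ else _.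
have [HP HP'] : quads ((n.*2 + b) %/ 16) P.1 /\ quads ((n.*2 + b) %/ 16).+1 P.2.
  rewrite /P; case: ltnP => h /=.
    rewrite (_ : (n.*2 + b) %/ 16 = (n %/ 16).*2); last by case: b sb; lia.
    by split; [apply: quads_even|apply: quads_odd].
  rewrite (_ : (n.*2 + b) %/ 16 = (n %/ 16).*2.+1); last by case: b sb; lia.
  by split; [apply: quads_odd|rewrite -doubleS; apply: quads_even].
split=> //= x.
have mP : qset (misaligned_vals P.1 P.2 (s.*2 %% 16 + b)) x <->
    exists2 i, misaligned i (n.*2 + b) & x = cce (win tm i (n.*2 + b)).
  have nE : n.*2 + b = 16 * ((n.*2 + b) %/ 16) + (s.*2 %% 16 + b).
    by rewrite sb mulnC -divn_eq.
  rewrite [in X in _ <-> X]nE; apply: misaligned_valsP => //; first by lia.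
  by rewrite sb ltn_mod.
rewrite ace_rec; last by lia.
have sub : {subset misaligned_vals P.1 P.2 (s.*2 %% 16 + b) ++
    (if b then [::] else S) <= vals}.
  move=> v; rewrite mem_cat => /orP[/sort_vals_sub //|].
  by case: ifP => // _ /subS.
split.
  case=> [[od]|/mP[v vm ->]]; last first.
    by exists v => //; rewrite mem_sort_vals // mem_cat vm.
  have bF : b = false by case: b od {mP sb P HP HP' sub} => //; lia.
  rewrite {1}bF addn0 doubleK => /aS[v vS ->]; exists v => //.
  by rewrite mem_sort_vals // mem_cat bF vS orbT.
move=> [v]; rewrite mem_sort_vals // mem_cat => /orP[vm|vS] xE.
  by right; apply/mP; exists v.
case: b vS {mP sb P HP HP' sub} => // vS; left; rewrite addn0 odd_double doubleK.
by split=> //; apply/aS; exists v.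
Qed.

Definition start (n : nat) : state := ((quads1, even_quads quads1), (n - 16, base_vals n)).

Lemma describes_start n : 16 <= n < 32 -> describes n (start n).
Proof.
move=> /andP[n16 n32]; have n1 : n %/ 16 = 1 by lia.
split=> /=; rewrite ?n1; [exact: quads1P| |lia|].
  exact: (quads_even _ quads1P).
by move=> x; apply: base_ace; rewrite n32 andbT; lia.
Qed.

Fixpoint state_of (k n : nat) : state :=
  if k is k'.+1 then
    if n < 32 then start n else step (state_of k' n./2) (odd n)
  else start n.

Fixpoint explore (k : nat) (seen todo : seq state) : seq state :=
  if k is k'.+1 then
    let next := undup [seq st <- [seq step st b | st <- todo, b <- bools]
                      | st \notin seen] in
    explore k' (seen ++ next) next
  else seen.

(** That thirty rounds of breadth-first search reach every state is certified by [states_closed]. *)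
Definition states : seq state :=
  Eval vm_compute in
  let init := map start (iota 16 16) in explore 30 init init.

Lemma closed_step (T : eqType) (f : T -> bool -> T) (r : seq T) x b :
  all (fun y => all (fun c => f y c \in r) bools) r -> x \in r -> f x b \in r.
Proof. by move=> /allP H /H/allP; apply; case: b. Qed.

Lemma states_closed : all (fun st => all (fun b => step st b \in states) bools) states.
Proof. by vm_compute. Qed.

Lemma step_states st b : st \in states -> step st b \in states.
Proof. exact: closed_step states_closed. Qed.

Lemma start_states n : 16 <= n < 32 -> start n \in states.
Proof.
have /allP H : all (fun n => start n \in states) (iota 16 16) by vm_compute.
by move=> hn; apply: H; rewrite mem_iota.
Qed.

Lemma states_vals st : st \in states -> {subset st.2.2 <= vals}.
Proof.
have /allP H : all (fun st => all (mem vals) st.2.2) states by vm_compute.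
by move=> /H/allP.
Qed.

Lemma state_ofP k n : 16 <= n -> n <= k + 16 ->
  state_of k n \in states /\ describes n (state_of k n).
Proof.
elim: k n => [|k IHk] n n16 le_n /=.
  by split; [apply: start_states|apply: describes_start]; lia.
case: ltnP => h.
  by split; [apply: start_states|apply: describes_start]; lia.
have [||st_in st_ok] := IHk n./2; try by lia.
split; first exact: step_states.
rewrite -{1}(odd_double_half n) addnC; apply: describes_step => //; first by lia.
exact: states_vals.
Qed.

Definition ace_code (n : nat) : seq (nat * nat) :=
  if n < 16 then base_vals n else (state_of n n).2.2.

Lemma aceE n : 0 < n -> ace n = qset (ace_code n).
Proof.
move=> n0; apply/predeqP => x; rewrite /ace_code; case: ltnP => h.
  by apply: base_ace; lia.
by have [_ []] := @state_ofP n n h (leq_addr _ _).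
Qed.

(* The k-th entry is the least n for which ace n is the k-th set of the list. *)
Definition witnesses : seq nat :=
  [:: 1; 2; 3; 4; 5; 6; 7; 8; 9; 10; 11; 13; 14; 17; 18; 19; 21; 22; 23; 25;
      26; 27; 31; 34; 38; 42; 46; 50; 54; 62; 74].

Definition codes : seq (seq (nat * nat)) :=
  Eval vm_compute in map ace_code witnesses.

Lemma codesE : codes = map ace_code witnesses.
Proof. by vm_compute. Qed.

Lemma ace_code_in n : 0 < n -> ace_code n \in codes.
Proof.
move=> n0; rewrite /ace_code; case: ltnP => h.
  have /allP H : all (fun n => base_vals n \in codes) (iota 1 15) by vm_compute.
  by apply: H; rewrite mem_iota; lia.
have /allP H : all (fun st => st.2.2 \in codes) states by vm_compute.
by have [/H] := @state_ofP n n h (leq_addr _ _).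
Qed.

(** The set notation of [ace_values] is a union nested to the left, hence [foldl] and an induction
    from the end. *)
Lemma qset_seq v S :
  qset (v :: S) = foldl (fun A w => A `|` [set quo w]) [set quo v] S.
Proof.
elim/last_ind: S => [|S w IHS].
  apply/predeqP => x; split=> [[u]|->]; first by rewrite inE => /eqP -> ->.
  by exists v; rewrite ?mem_head.
rewrite foldl_rcons -IHS; apply/predeqP => x; split=> [[u]|].
  rewrite -rcons_cons mem_rcons inE => /orP[/eqP -> ->|uS xE]; first by right.
  by left; exists u.
case=> [[u uS xE]|->].
  by exists u => //; rewrite -rcons_cons mem_rcons inE uS orbT.
by exists w => //; rewrite -rcons_cons mem_rcons mem_head.
Qed.

Lemma ace_valuesE : map qset codes = ace_values.
Proof.
by rewrite /= !qset_seq /quo /= !divr1.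
Qed.

(** The fractions in [vals] are pairwise distinct, so a set determines which of them occur and
    thereby its sorted code. *)
Lemma qset_inj S S' : sort_vals S = S -> sort_vals S' = S' -> qset S = qset S' -> S = S'.
Proof.
have mem_qset T v : sort_vals T = T -> v \in vals -> (v \in T) <-> qset T (quo v).
  move=> TE vv; split=> [vT|[w wT]]; first by exists v.
  have wv : w \in vals by move: wT; rewrite -TE => /sort_vals_sub.
  have H : all (fun v => all (fun w => (v.1 * w.2 == w.1 * v.2) ==> (v == w)) vals) vals.
    by vm_compute.
  move=> /eqP; rewrite eq_quo ?vals_pos //.
  by have /allP/(_ _ vv)/allP/(_ _ wv)/implyP H' := H; move=> /H'/eqP ->.
move=> SE SE' E; rewrite -SE -SE'; apply: eq_in_filter => v vv.
apply/idP/idP.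
  by move/(mem_qset _ _ SE vv); rewrite E => /(mem_qset _ _ SE' vv).
by move/(mem_qset _ _ SE' vv); rewrite -E => /(mem_qset _ _ SE vv).
Qed.

Lemma uniq_ace_values : uniq ace_values.
Proof.
rewrite -ace_valuesE map_inj_in_uniq; first by vm_compute.
have /allP H : all (fun S => sort_vals S == S) codes by vm_compute.
by move=> S S' /H/eqP SE /H/eqP SE'; apply: qset_inj.
Qed.

End Automaton.

Theorem theorem16 :
  [set ace n | n in [set n | (0 < n)%N]] = [set` ace_values]
  /\ size ace_values = 31
  /\ uniq ace_values.
Proof.
split; last by split; [|exact: uniq_ace_values].
rewrite -ace_valuesE; apply/predeqP => A; split=> [[n n0 <-]|].
  by rewrite aceE //; apply: (map_f qset); exact: ace_code_in.
move=> mem_A; have /mapP[S] : A \in map qset codes := mem_A.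
rewrite codesE => /mapP[n n_wit ->] ->.
have n0 : 0 < n.
  have /allP H : all (fun n => 0 < n) witnesses by [].
  exact: H.
by exists n; rewrite ?aceE.
Qed.
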